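(* Let $x\in\mathcal{X}$, let $\mathcal{I}$ and $\mathcal{J}$ be two fixed disjoint sets of indices with $\mathcal{I}\cup\mathcal{J}=[m]$, and let $\mathcal{B}$ be a random multiset of cardinality $|\mathcal{B}|=\tau$ with elements from $[m]$, drawn as described in the context. Suppose that $f$ is partially separable of degree $\omega$. Set $$q=\delta_{DP}|\mathcal{I}|+|\mathcal{J}|,\qquad \beta=\frac{(\tau-1)\left(\delta_{DP}\min\{|\mathcal{I}|,\omega\}+\min\{|\mathcal{J}|,\omega\}\right)}{q}+1,$$ and let $h^\beta=[h^\beta_1,\dots,h^\beta_m]^T\in\mathbb{R}^n$, where for each $i\in[m]$ the block $h^\beta_i\in\mathbb{R}^{p_i}$ is the solution of $$\min_{h\in\mathbb{R}^{p_i}}\ \nabla_i f(x)^T h+\frac{\beta L_i}{2}\|h\|_{(i)}^2+\psi_i(x_{(i)}+h)-\psi_i(x_{(i)})\quad\text{s.t.}\quad l\le x+U_ih\le u.$$ Then $$\mathbb{E}\left[f\Big(x+\sum_{i\in\mathcal{B}}U_ih^\beta_i\Big)\right]\le f(x)+\sum_{i\in\mathcal{I}}\frac{\tau\delta_{DP}}{q}\left(\nabla_i f(x)^Th^\beta_i+\frac{\beta L_i}{2}\|h^\beta_i\|_{(i)}^2\right)+\sum_{i\in\mathcal{J}}\frac{\tau}{q}\left(\nabla_i f(x)^Th^\beta_i+\frac{\beta L_i}{2}\|h^\beta_i\|_{(i)}^2\right).$$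
   Context: Notation: $[m]=\{1,\dots,m\}$. The vector $x\in\mathbb{R}^n$ is split into $m$ disjoint blocks $x_{(i)}\in\mathbb{R}^{p_i}$, $\sum_{i=1}^m p_i=n$; $U_i\in\mathbb{R}^{n\times p_i}$ are matrices whose columns are canonical vectors, with $x=\sum_{i=1}^m U_ix_{(i)}$ and $x_{(i)}=U_i^Tx$. Inequalities between vectors are componentwise. The vectors $l,u$ have components in $[-\infty,+\infty]$ with $l_j<u_j$, and $\mathcal{X}=\{x\in\mathbb{R}^n: l\le x\le u\}$. Functions: $f:\mathbb{R}^n\to\mathbb{R}$ is convex and smooth, $\psi:\mathbb{R}^n\to\mathbb{R}$ is convex, possibly nonsmooth, and block separable: $\psi(x)=\sum_{i=1}^m\psi_i(x_{(i)})$. For $i\in[m]$, $B_i$ is a fixed symmetric positive definite matrix of order $p_i$, $\|y\|_{(i)}=\sqrt{y^TB_iy}$ and $\|y\|_{(i)}^*=\sqrt{y^TB_i^{-1}y}$ for $y\in\mathbb{R}^{p_i}$. With $\nabla_i f(x)=U_i^T\nabla f(x)$, there are constants $L_i>0$ such that $\|\nabla_i f(x+U_ih_i)-\nabla_i f(x)\|_{(i)}^*\le L_i\|h_i\|_{(i)}$ for all $h_i\in\mathbb{R}^{p_i}$, all $x\in\mathcal{X}$, and all $i\in[m]$. Partial separability: the convex smooth function $f$ is partially separable of degree $\omega$ if there is a finite collection $\mathcal{S}$ of nonempty subsets of $[m]$ and differentiable convex functions $f_S$, $S\in\mathcal{S}$, such that $f(x)=\sum_{S\in\mathcal{S}}f_S(x)$,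 each $f_S$ depends only on the blocks $x_{(i)}$ with $i\in S$, and $|S|\le\omega$ for all $S\in\mathcal{S}$. Random multiset: $\delta_{DP}$ and $\tau$ are positive integers. $\mathcal{B}$ consists of $\tau$ indices from $[m]$, repetitions allowed, drawn independently, each drawn index being equal to $i$ with probability $\frac{\delta_{DP}}{\delta_{DP}|\mathcal{I}|+|\mathcal{J}|}$ if $i\in\mathcal{I}$ and $\frac{1}{\delta_{DP}|\mathcal{I}|+|\mathcal{J}|}$ if $i\in\mathcal{J}$. Sums over $i\in\mathcal{B}$ run over the elements of the multiset counted with multiplicity. The expectation is over the choice of $\mathcal{B}$. *)

(* Defs.v *)
From mathcomp Require Import all_boot all_order all_algebra.
From mathcomp Require Import all_classical all_reals all_analysis.

Set Implicit Arguments.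
Unset Strict Implicit.
Unset Printing Implicit Defensive.

Import Order.TTheory GRing.Theory Num.Theory.
Import numFieldNormedType.Exports.

Local Open Scope classical_set_scope.
Local Open Scope ring_scope.

Section VectorCalculus.
Variable R : realType.

Definition dotv n (a b : 'cV[R]_n) : R := (a^T *m b) 0 0.

Definition posdefmx n (B : 'M[R]_n) : Prop :=
  B^T = B /\ forall y : 'cV[R]_n, y != 0 -> 0 < (y^T *m B *m y) 0 0.

Definition normB n (B : 'M[R]_n) (y : 'cV[R]_n) : R :=
  Num.sqrt ((y^T *m B *m y) 0 0).

Definition dual_normB n (B : 'M[R]_n) (y : 'cV[R]_n) : R :=
  Num.sqrt ((y^T *m invmx B *m y) 0 0).

(* The gradient at [x]; as ['D_v f x] is total, this is meaningful only where
   [f] is differentiable. *)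
Definition grad n (f : 'cV[R]_n -> R) (x : 'cV[R]_n) : 'cV[R]_n :=
  \col_(j < n) 'D_(delta_mx j 0) f x.

Definition convex_fun n (f : 'cV[R]_n -> R) : Prop :=
  @convex_function R 'cV[R]_n [set: _] f.

Definition box n (l u : 'cV[\bar R]_n) : set 'cV[R]_n :=
  [set x | forall j : 'I_n, (l j 0%R <= (x j 0%R)%:E <= u j 0%R)%E].

Definition is_argmin (T : Type) (D : set T) (F : T -> R) (x : T) : Prop :=
  D x /\ forall y, D y -> F x <= F y.

End VectorCalculus.

Section Blocks.
Variables (R : realType) (n m : nat) (p : 'I_m -> nat).
Variable U : forall i : 'I_m, 'M[R]_(n, p i).

Definition blk (i : 'I_m) (x : 'cV[R]_n) : 'cV[R]_(p i) := (U i)^T *m x.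

(* The last two conjuncts force every canonical vector to occur exactly once
   among the columns of the [U i], so that the blocks are disjoint. The blocks
   need not consist of consecutive coordinates. *)
Definition block_decomposition : Prop :=
  [/\ (\sum_(i < m) p i)%N = n,
      forall (i : 'I_m) (k : 'I_(p i)), exists j : 'I_n,
        col k (U i) = delta_mx j 0
    & forall x : 'cV[R]_n, x = \sum_(i < m) U i *m blk i x].

Definition depends_only_on (A : {set 'I_m}) (g : 'cV[R]_n -> R) : Prop :=
  forall x y : 'cV[R]_n, (forall i, i \in A -> blk i x = blk i y) -> g x = g y.

Definition partially_separable (omega : nat) (f : 'cV[R]_n -> R) : Prop :=
  exists (S : {set {set 'I_m}}) (fS : {set 'I_m} -> 'cV[R]_n -> R),
    (forall x, f x = \sum_(A in S) fS A x) /\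
    (forall A, A \in S ->
       [/\ A != finset.set0, (#|A| <= omega)%N,
           (forall x, differentiable (fS A) x),
           convex_fun (fS A)
         & depends_only_on A (fS A)]).

End Blocks.

(* Random elements of a finite type [K], which carries the discrete
   sigma-algebra. The library's [{RV P >-> _}] is not used because a
   [measurableType] is pointed and ['I_m] is not. *)
Definition fin_random d (T : measurableType d) (K : finType) (X : T -> K) : Prop :=
  forall A : set K, measurable (X @^-1` A).

Definition mutually_independent (R : realType) d (T : measurableType d)
    (P : probability T R) (N K : finType) (X : N -> T -> K) : Prop :=
  forall (Q : {set N}) (A : N -> set K),
    P (\bigcap_(k in [set` Q]) (X k @^-1` A k)) =
    (\prod_(k in Q) P (X k @^-1` A k))%E.

(* Main.v *)
Require Import Defs.
From mathcomp Require Import all_boot all_order all_algebra.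
From mathcomp Require Import all_classical all_reals all_analysis.
From mathcomp Require Import ring lra.

(** Write f as the sum of its components f_A. If the drawn multiset contains N
    indices of A, counted with multiplicity, then only these N directions move
    f_A, and Jensen's inequality for the average of the N points
    x + N U_i h_i gives

      f_A(x + sum U_i h_i) - f_A(x) <= sum over the hits i of s_{A,i}(N),
      s_{A,i}(c) = (f_A(x + c U_i h_i) - f_A(x)) / c

    ([sub_le_sum_chord_slope]). In expectation, each i in A is drawn at each of
    the tau positions with probability w_i, and given such a hit N is distributed
    as 1 + Bin(tau - 1, w(A)), where w(A) is the probability that one draw falls in
    A ([mean_hits]).

    The laws of N differ from component to component, which would prevent summing
    over A. But s_{A,i} is nondecreasing by convexity ([chord_slope_le]), and
    w(A) <= rho = (delta min(|I|, omega) + min(|J|, omega)) / q, so N may be replaced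
    by 1 + Bin(tau - 1, rho), which dominates it stochastically
    ([binomial_step_le_prob]). Now the slopes of the components add up to the slope
    of f, and the block Lipschitz condition bounds the latter
    ([block_descent]) by

      (f(x + c U_i h_i) - f(x)) / c <= g_i^T h_i + c (L_i / 2) |h_i|_i^2,

    where g_i is the i-th block of the gradient of f at x.
    The right-hand side is affine in c, so only the mean
    1 + (tau - 1) rho = beta of the dominating law matters
    ([mean_separable_le]). *)

Set Implicit Arguments.
Unset Strict Implicit.
Unset Printing Implicit Defensive.

Import Order.TTheory GRing.Theory Num.Theory.
Import numFieldNormedType.Exports.

Local Open Scope classical_set_scope.
Local Open Scope ring_scope.

(** * Convexity along chords *)

Section Convexity.
Variables (R : realType) (n : nat).
Implicit Types (g : 'cV[R]_n -> R) (x v : 'cV[R]_n).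

Lemma convex_funP g (t : R) x y : convex_fun g -> 0 <= t <= 1 ->
  g (t *: x + (1 - t) *: y) <= t * g x + (1 - t) * g y.
Proof.
move=> cg t01.
have it : Itv.spec (Itv.num_sem (R := R)) (Itv.Real `[0%Z, 1%Z]) t.
  rewrite /= /Itv.num_sem /= in_itv /= t01 andbT; apply: ger0_real.
  by case/andP: t01.
have := cg (Itv.mk it) x y (mem_setT x) (mem_setT y).
by rewrite convRE.
Qed.

(** Jensen's inequality: peel off one of k + 1 points with weight 1 / (k + 1);
    the others keep their uniform average. *)
Lemma convex_mean_le (T : Type) (r : seq T) (v : T -> 'cV[R]_n) g :
  convex_fun g -> (0 < size r)%N ->
  g ((size r)%:R^-1 *: \sum_(i <- r) v i)
  <= (size r)%:R^-1 * \sum_(i <- r) g (v i).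
Proof.
move=> cg; elim: r => [//|a r IH] _.
rewrite !big_cons [size _]/=.
case: (posnP (size r)) => [/size0nil ->|r0].
  by rewrite /= !big_nil !addr0 invr1 scale1r mul1r.
set k : R := (size r)%:R.
have k0 : 0 < k by rewrite ltr0n.
have k1 : 0 < k + 1 by rewrite addr_gt0.
have inv01 : 0 <= (k + 1)^-1 <= 1.
  by rewrite invr_ge0 ltW// invf_le1// lerDr ltW.
rewrite -(natr1 (size r)) -/k.
have -> : (k + 1)^-1 *: (v a + \sum_(i <- r) v i) =
   (k + 1)^-1 *: v a + (1 - (k + 1)^-1) *: (k^-1 *: \sum_(i <- r) v i).
  rewrite scalerDr scalerA; congr (_ + _ *: _).
  by field; rewrite !gt_eqF.
apply: (le_trans (convex_funP _ _ cg inv01)).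
have -> : (k + 1)^-1 * (g (v a) + \sum_(i <- r) g (v i)) =
   (k + 1)^-1 * g (v a) + (1 - (k + 1)^-1) * (k^-1 * \sum_(i <- r) g (v i)).
  by field; rewrite !gt_eqF.
by rewrite lerD2l ler_wpM2l ?IH// subr_ge0; case/andP: inv01.
Qed.

(** The index is shifted: [chord_slope g x v c] is the slope over c + 1 steps
    of [v], so that every natural number [c] gives a nondegenerate chord. *)
Definition chord_slope g x v (c : nat) : R :=
  (g (x + c.+1%:R *: v) - g x) / c.+1%:R.

(** [x + (c+1) *: v] is a convex combination of [x] and [x + (c+2) *: v]. *)
Lemma chord_slope_le g x v c : convex_fun g ->
  chord_slope g x v c <= chord_slope g x v c.+1.
Proof.
move=> cg; rewrite /chord_slope.
set a : R := c.+1%:R.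
have a0 : 0 < a by rewrite ltr0n.
have -> : c.+2%:R = a + 1 by rewrite -natr1.
have a1 : 0 < a + 1 by rewrite addr_gt0.
rewrite ler_pdivrMr// mulrAC ler_pdivlMr//.
have -> : x + a *: v =
    (a / (a + 1)) *: (x + (a + 1) *: v) + (1 - a / (a + 1)) *: x.
  rewrite scalerDr scalerA divfK ?gt_eqF// addrAC -scalerDl.
  by rewrite addrC subrKC scale1r addrC.
have := convex_funP (x + (a + 1) *: v) x cg (t := a / (a + 1)).
rewrite divr_ge0 ?(ltW a0) ?(ltW a1)// ler_pdivrMr// mul1r lerDl ler01.
move=> /(_ isT); rewrite -(ler_pM2r a1).
have -> : (a / (a + 1) * g (x + (a + 1) *: v) + (1 - a / (a + 1)) * g x)
   * (a + 1) = a * g (x + (a + 1) *: v) + g x.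
  by field; rewrite gt_eqF.
lra.
Qed.

(** A sum of k directions is the uniform average of the same directions
    stretched by k, to which Jensen's inequality applies: each of the k chords
    then contributes its slope. The empty sum is the trivial case 0 <= 0. *)
Lemma sub_le_sum_chord_slope (T : Type) (r : seq T) (v : T -> 'cV[R]_n) g x :
  convex_fun g ->
  g (x + \sum_(i <- r) v i) - g x
  <= \sum_(i <- r) chord_slope g x (v i) (size r).-1.
Proof.
move=> cg; case: (posnP (size r)) => [/size0nil ->|r0].
  by rewrite !big_nil addr0 subrr.
have k0 : 0 < (size r)%:R :> R by rewrite ltr0n.
have := convex_mean_le (fun i => x + (size r)%:R *: v i) cg r0.
have sumx (V : zmodType) (z : V) : \sum_(i <- r) z = z *+ size r.
  by rewrite big_const_seq count_predT iter_addr_0.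
rewrite big_split /= -scaler_sumr scalerDr scalerA mulVf ?gt_eqF// scale1r.
rewrite sumx -(scaler_nat (size r) x) scalerA mulVf ?gt_eqF// scale1r => le_g.
rewrite /chord_slope prednK// -mulr_suml sumrB sumx mulrBl.
rewrite -(mulr_natr (g x)) mulfK ?gt_eqF//.
by rewrite mulrC lerD2r.
Qed.

End Convexity.

(** * Stochastic order of binomial laws *)

Section BinomialStep.
Variable R : realDomainType.
Implicit Types (p : R) (g h : nat -> R).

(** One Bernoulli trial: the [n]-th iterate at [c] is the expectation of
    g (c + N) for N binomial with parameters [n] and [p]. Iterating this operator
    replaces any manipulation of binomial coefficients. *)
Definition binomial_step p g : nat -> R := fun c => (1 - p) * g c + p * g c.+1.

Local Notation T p n := (iter n (binomial_step p)).

Lemma binomial_step_le p n g h c : 0 <= p <= 1 -> (forall c, g c <= h c) ->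
  T p n g c <= T p n h c.
Proof.
move=> /andP[p0 p1]; elim: n g h c => [|n IH] g h c gh //=.
by rewrite /binomial_step lerD// ler_wpM2l ?subr_ge0// IH.
Qed.

Lemma binomial_step_nondecreasing p n g c : 0 <= p <= 1 ->
  (forall c, g c <= g c.+1) -> T p n g c <= T p n g c.+1.
Proof.
move=> /andP[p0 p1]; elim: n g c => [|n IH] g c gS //=.
by rewrite /binomial_step lerD// ler_wpM2l ?subr_ge0// IH.
Qed.

(** Binomial laws with a larger success probability dominate stochastically:
    for nondecreasing [g], one step with [p'] exceeds one step with [p] by
    (p' - p) times an increment of [g], and steps preserve monotonicity. *)
Lemma binomial_step_le_prob p p' n g c : 0 <= p -> p <= p' -> p' <= 1 ->
  (forall c, g c <= g c.+1) -> T p n g c <= T p' n g c.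
Proof.
move=> p0 pp' p'1 gS; elim: n c => [|n IH] c //=.
have p1 := le_trans pp' p'1.
apply: (@le_trans _ _ (binomial_step p (T p' n g) c)).
  by rewrite /binomial_step lerD// ler_wpM2l ?subr_ge0.
have : T p' n g c <= T p' n g c.+1.
  by apply: binomial_step_nondecreasing; rewrite ?p'1 ?(le_trans p0).
rewrite -subr_ge0 => d0; rewrite -subr_ge0 /binomial_step.
rewrite [leRHS](_ : _ = (p' - p) * (T p' n g c.+1 - T p' n g c)).
  by rewrite mulr_ge0 // subr_ge0.
by rewrite /binomial_step; ring.
Qed.

Lemma binomial_step_affine p n (a b : R) c :
  T p n (fun k => a + b * k%:R) c = a + b * (c%:R + n%:R * p).
Proof.
elim: n c => [|n IH] c /=; first by rewrite mul0r addr0.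
by rewrite /binomial_step !IH -!natr1; ring.
Qed.

Lemma binomial_step_sum p n (K : finType) (D : {pred K}) (g : K -> nat -> R) c :
  T p n (fun k => \sum_(i in D) g i k) c = \sum_(i in D) T p n (g i) c.
Proof.
elim: n c => [|n IH] c //=.
by rewrite /binomial_step !IH !mulr_sumr -big_split.
Qed.

End BinomialStep.

(** * Averages over independent draws *)

Section IndependentDraws.
Variables (R : realDomainType) (K : finType) (w : K -> R).
Hypothesis w_sum1 : \sum_i w i = 1.
Implicit Types (F G : seq K -> R) (A : {set K}).

(** The expectation of [F] over [n] independent draws from the law [w]. *)
Definition mean n F : R := \sum_(t : n.-tuple K) (\prod_(i <- t) w i) * F t.

Lemma meanS n F : mean n.+1 F = \sum_i w i * mean n (fun s => F (i :: s)).
Proof.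
under [RHS]eq_bigr do rewrite mulr_sumr.
rewrite pair_big /= /mean.
rewrite (reindex (fun it : K * n.-tuple K => [tuple of it.1 :: it.2])) /=.
  by apply: eq_bigr => -[i t] _; rewrite big_cons mulrA.
exists (fun t => (thead t, [tuple of behead t])) => [[i t]|t] _ /=.
  by congr (_, _); apply: val_inj.
by rewrite -tuple_eta.
Qed.

Lemma mean0 F : mean 0 F = F [::].
Proof.
rewrite /mean (bigD1 [tuple]) //= big_nil mul1r big1 ?addr0 // => t.
by rewrite tuple0.
Qed.

Lemma eq_mean n F G : F =1 G -> mean n F = mean n G.
Proof. by move=> FG; apply: eq_bigr => t _; rewrite FG. Qed.

Lemma meanD n F G : mean n (fun s => F s + G s) = mean n F + mean n G.
Proof. by rewrite /mean -big_split; apply: eq_bigr => t _; rewrite mulrDr. Qed.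

Lemma mean_sum n (T : finType) (D : {pred T}) (F : T -> seq K -> R) :
  mean n (fun s => \sum_(k in D) F k s) = \sum_(k in D) mean n (F k).
Proof.
by rewrite exchange_big; apply: eq_bigr => t _; rewrite mulr_sumr.
Qed.

Lemma mean_cst n (a : R) : mean n (fun=> a) = a.
Proof.
elim: n => [|n IH]; first by rewrite mean0.
by rewrite meanS; under eq_bigr do rewrite IH; rewrite -mulr_suml w_sum1 mul1r.
Qed.

Lemma le_mean n F G : (forall i, 0 <= w i) ->
  (forall s, size s = n -> F s <= G s) -> mean n F <= mean n G.
Proof.
move=> w0 FG; apply: ler_sum => t _.
by rewrite ler_wpM2l ?prodr_ge0 ?FG ?size_tuple.
Qed.

Definition hit_prob A : R := \sum_(i in A) w i.

Lemma mean_cond A n F : mean n.+1 F =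
  \sum_(i in A) w i * mean n (fun s => F (i :: s)) +
  \sum_(i in ~: A) w i * mean n (fun s => F (i :: s)).
Proof.
rewrite meanS (bigID (mem A)) /=; congr (_ + _).
by apply: eq_bigl => i; rewrite inE.
Qed.

Lemma hit_probC A : hit_prob (~: A) = 1 - hit_prob A.
Proof.
rewrite -w_sum1 /hit_prob [X in _ = X - _](bigID (mem A)) /= addrAC subrr add0r.
by apply: eq_bigl => i; rewrite inE.
Qed.

Lemma mean_count A n (g : nat -> R) c :
  mean n (fun s => g (c + count [in A] s)%N) =
  iter n (binomial_step (hit_prob A)) g c.
Proof.
elim: n c => [|n IH] c; first by rewrite mean0 addn0.
rewrite (mean_cond A) /= {1}/binomial_step -hit_probC addrC; congr (_ + _).
  rewrite /hit_prob mulr_suml; apply: eq_bigr => i; rewrite inE => /negbTE iA.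
  by rewrite -IH; congr (_ * _); apply: eq_mean => s; rewrite iA.
rewrite /hit_prob mulr_suml; apply: eq_bigr => i iA.
by rewrite -IH; congr (_ * _); apply: eq_mean => s; rewrite iA addnS addSn.
Qed.

(** By symmetry each of the [n] draws contributes equally; given that a draw is
    an index i of [A], the number of other hits of [A] is binomial with n - 1
    trials. Since [s] has count - 1 hits besides the one summed over, this is the
    shift by which [chord_slope] is indexed. The induction removes the first draw,
    and the offset [c] records the hits already seen. *)
Lemma mean_hits A n (g : K -> nat -> R) c :
  mean n (fun s => \sum_(i <- s | i \in A) g i (c + (count [in A] s).-1)%N) =
  n%:R * \sum_(i in A) w i * iter n.-1 (binomial_step (hit_prob A)) (g i) c.
Proof.
elim: n c => [|n IH] c; first by rewrite mean0 big_nil mul0r.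
pose W c := mean n (fun s =>
  \sum_(i <- s | i \in A) g i (c + (count [in A] s).-1)%N).
(* Condition on the first draw. A miss leaves the same problem with one draw
   fewer; a hit i contributes g i at the number of further hits, and raises the
   number of hits counted at every later one. *)
have notA i : i \in ~: A -> mean n (fun s => \sum_(j <- i :: s | j \in A)
    g j (c + (count [in A] (i :: s)).-1)%N) = W c.
  rewrite inE => /negbTE iA; apply: eq_mean => s.
  by rewrite big_cons iA /= iA.
have inA i : i \in A -> mean n (fun s => \sum_(j <- i :: s | j \in A)
    g j (c + (count [in A] (i :: s)).-1)%N) =
    iter n (binomial_step (hit_prob A)) (g i) c + W c.+1.
  move=> iA; rewrite -mean_count -meanD; apply: eq_mean => s.
  rewrite big_cons iA /= iA /=; congr (_ + _).
  have [s0|s0] := posnP (count [in A] s); last by rewrite addSnnS prednK.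
  have no_hit (h : K -> R) : \sum_(j <- s | j \in A) h j = 0.
    rewrite -big_filter (size0nil (s := [seq j <- s | j \in A])) ?big_nil //.
    by rewrite size_filter.
  by rewrite !no_hit.
rewrite (mean_cond A).
under eq_bigr => i iA do rewrite inA // mulrDr.
under [X in _ + X]eq_bigr => i iA do rewrite notA //.
rewrite big_split /= -!mulr_suml -/(hit_prob A) -/(hit_prob (~: A)) hit_probC.
rewrite -addrA -[n.+1%:R]natr1 [RHS]mulrDl mul1r [RHS]addrC; congr (_ + _).
rewrite /W !IH.
case: n {IH W notA inA} => [|n]; first by rewrite !mul0r !mulr0 addr0.
rewrite mulrCA [X in _ + X]mulrCA -mulrDr; congr (_ * _).
rewrite !mulr_sumr -big_split; apply: eq_bigr => i _ /=.
by rewrite {3}/binomial_step; ring.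
Qed.

End IndependentDraws.

(** * Orthogonality of the blocks *)

Section Blocks.
Variables (R : realType) (n m : nat) (p : 'I_m -> nat).
Variable U : forall i : 'I_m, 'M[R]_(n, p i).
Hypothesis hU : block_decomposition U.

(** With M the juxtaposition of the [U i], the decomposition says that M M^T is
    the identity; the sizes make M square, hence M^T M is the identity too, and
    its off-diagonal blocks are the products U_i^T U_j. *)
Lemma blk_disjoint i j (h : 'cV[R]_(p j)) : i != j -> blk U i (U j *m h) = 0.
Proof.
case: hU => size_p _ decomp ij; rewrite /blk mulmxA.
suff -> : (U i)^T *m U j = 0 by rewrite mul0mx.
pose M : 'M[R]_(n, (\sum_(i < m) p i)%N) := \mxrow_i U i.
have MMt : M *m M^T = 1%:M.
  rewrite tr_mxrow mul_mxrow_mxcol; apply/matrixP => a b.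
  have /matrixP/(_ a 0) := decomp (delta_mx b 0).
  rewrite /blk; under eq_bigr do rewrite mulmxA.
  rewrite -mulmx_suml -colE !mxE eqxx andbT.
  by move=> ->.
have MtM : M^T *m M = 1%:M.
  move: M MMt; rewrite size_p => M; exact: mulmx1C.
have := congr1 (fun N => submxblock N i j) MtM.
rewrite tr_mxrow mul_mxcol_mxrow mxblockK => ->.
by rewrite -mxdiagZ /mxdiag mxblockK ifN.
Qed.

End Blocks.

(** * Cauchy-Schwarz inequality for the dual norm *)

Section Quadratic.
Variables (R : realType) (k : nat) (B : 'M[R]_k).
Hypothesis hB : posdefmx B.
Implicit Types a h y : 'cV[R]_k.

Lemma quad_ge0 y : 0 <= (y^T *m B *m y) 0 0.
Proof.
have [->|y0] := eqVneq y 0; first by rewrite mulmx0 mxE.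
by rewrite ltW //; apply: hB.2.
Qed.

(** A nonzero kernel vector y would give y^T B y = 0. *)
Lemma posdefmx_unit : B \in unitmx.
Proof.
rewrite -row_free_unit -kermx_eq0; apply/eqP/row_matrixP => i; rewrite row0.
apply/eqP; apply: contraT => r0.
have := hB.2 (row i (kermx B))^T.
rewrite trmx_eq0 => /(_ r0); rewrite trmxK.
by rewrite -row_mul mulmx_ker row0 mul0mx mxE ltxx.
Qed.

Lemma normB_sqr y : normB B y ^+ 2 = (y^T *m B *m y) 0 0.
Proof. by rewrite sqr_sqrtr ?quad_ge0. Qed.

(** With y the solution of B y = a, the quadratic form of [B] at y - t h is a
    nonnegative quadratic polynomial in t; nonnegativity at its minimiser is the
    square of the inequality. *)
Lemma dotv_dual_le a h : dotv a h <= dual_normB B a * normB B h.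
Proof.
have Bu := posdefmx_unit; have [Bt _] := hB.
set y := invmx B *m a.
have By : B *m y = a by rewrite mulKVmx.
have hBy : (h^T *m B *m y) 0 0 = dotv a h.
  by rewrite -mulmxA By /dotv -[in RHS](trmxK h) -trmx_mul [RHS]mxE.
have yBh : (y^T *m B *m h) 0 0 = dotv a h.
  by rewrite -{1}Bt -trmx_mul By.
have yBy : (y^T *m B *m y) 0 0 = dual_normB B a ^+ 2.
  have e : a^T *m invmx B *m a = y^T *m B *m y.
    by rewrite -[in RHS]mulmxA By /y trmx_mul trmx_inv Bt.
  by rewrite /dual_normB e sqr_sqrtr ?quad_ge0.
have quad_sub (t : R) :
    0 <= dual_normB B a ^+ 2 - 2 * t * dotv a h + t ^+ 2 * normB B h ^+ 2.
  have -> : dual_normB B a ^+ 2 - 2 * t * dotv a h + t ^+ 2 * normB B h ^+ 2 =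
      ((y - t *: h)^T *m B *m (y - t *: h)) 0 0.
    have -> : (y - t *: h)^T = y^T - t *: h^T by rewrite linearB linearZ.
    rewrite !mulmxBl !mulmxBr -!scalemxAl -!scalemxAr.
    rewrite normB_sqr -yBy.
    move: hBy yBh.
    by rewrite !mxE => -> ->; ring.
  exact: quad_ge0.
have n0 : 0 <= normB B h by exact: sqrtr_ge0.
have d0 : 0 <= dual_normB B a by exact: sqrtr_ge0.
have [h0|h0] := eqVneq h 0.
  by rewrite h0 /dotv mulmx0 mxE mulr_ge0 ?sqrtr_ge0.
have hBh : 0 < normB B h ^+ 2 by rewrite normB_sqr hB.2.
set N := normB B h in n0 hBh quad_sub *.
set D := dual_normB B a in d0 quad_sub *.
have [ah0|ah0] := ltP 0 (dotv a h); last first.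
  by apply: (le_trans ah0); rewrite mulr_ge0.
rewrite -ler_sqr ?nnegrE ?mulr_ge0 ?(ltW ah0) // exprMn.
(* The minimiser of the quadratic polynomial. *)
have := quad_sub (dotv a h / N ^+ 2).
rewrite -(pmulr_lge0 _ hBh).
have -> : (D ^+ 2 - 2 * (dotv a h / N ^+ 2) * dotv a h +
  (dotv a h / N ^+ 2) ^+ 2 * N ^+ 2) * N ^+ 2 = D ^+ 2 * N ^+ 2 - dotv a h ^+ 2.
  by field; rewrite -(sqrf_eq0 N) gt_eqF.
by rewrite subr_ge0.
Qed.

End Quadratic.

(** * Expectation as a finite average *)

Section Expectation.
Variables (R : realType) (d : measure_display) (Omega : measurableType d).
Variable P : probability Omega R.

(** The variable is a finite combination of indicators of the level sets
    of [X]. *)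
Lemma expectation_finite (K : finType) (X : Omega -> K) (g : K -> R) :
  (forall k, measurable (X @^-1` [set k])) ->
  ('E_P[fun w => g (X w)] = \sum_k (g k)%:E * P (X @^-1` [set k]))%E.
Proof.
move=> mX; rewrite unlock.
have -> : (fun w => (g (X w))%:E) =
    (fun w => \sum_k ((g k)%:E * (\1_(X @^-1` [set k]) w)%:E)%E).
  apply/funext => w; rewrite (bigD1 (X w)) //= big1 => [|k kX].
    by rewrite indicE mem_set //= mule1 adde0.
  by rewrite indicE memNset ?mule0 // => /esym/eqP; rewrite (negbTE kX).
have int_ind k : P.-integrable [set: Omega]
    (fun w => ((\1_(X @^-1` [set k]) w : R)%:E)).
  exact: integrable_indic.
rewrite integral_sum //; last by move=> k; exact: integrableZl.
apply: eq_bigr => k _.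
by rewrite integralZl // integral_indic // setIT.
Qed.

(** Independence turns the probability of each outcome of the whole sequence of
    draws into the product of the weights that defines [mean]. *)
Lemma expectation_iid (K : finType) (w : K -> R) tau
    (draw : 'I_tau -> Omega -> K) (F : seq K -> R) :
  (forall k, fin_random (draw k)) -> mutually_independent P draw ->
  (forall k i, P (draw k @^-1` [set i]) = (w i)%:E) ->
  ('E_P[fun v => F [seq draw k v | k <- enum 'I_tau]] = (mean w tau F)%:E)%E.
Proof.
move=> draw_meas indep draw_w.
pose X v : tau.-tuple K := mktuple (fun k => draw k v).
have preX t : X @^-1` [set t] =
    \bigcap_(k in [set` [set: 'I_tau]%SET]) (draw k @^-1` [set tnth t k]).
  apply/seteqP; split => [v <- k _ /=|v Xv]; first by rewrite tnth_mktuple.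
  by apply: eq_from_tnth => k; rewrite tnth_mktuple; apply: Xv; rewrite /= inE.
rewrite (expectation_finite (X := X) (fun t : tau.-tuple K => F t)); last first.
  move=> t; rewrite preX; apply: fin_bigcap_measurable => // k _.
  exact: draw_meas.
rewrite /mean -sumEFin; apply: eq_bigr => t _.
rewrite preX indep (eq_bigr (fun k => (w (tnth t k))%:E)) => [|k _].
  rewrite prodEFin -EFinM mulrC big_tuple; congr (_ * _)%:E.
  by apply: eq_bigl => k; rewrite inE.
exact: draw_w.
Qed.

End Expectation.

(** * Quadratic upper bound along a block *)

Section Smoothness.
Variable R : realType.

Lemma dotv_grad n (f : 'cV[R]_n -> R) (y v : 'cV[R]_n) :
  differentiable f y -> dotv (grad f y) v = 'D_v f y.
Proof.
move=> df; rewrite deriveE // [in RHS](_ : v = \sum_j v j 0 *: delta_mx j 0).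
  rewrite linear_sum /dotv mxE; apply: eq_bigr => j _.
  by rewrite linearZ -deriveE // [X in X * _]mxE [X in X * _]mxE; exact: mulrC.
by rewrite [LHS]matrix_sum_delta; apply: eq_bigr => j _; rewrite big_ord1.
Qed.

(** The difference quotient of the restriction of [f] to the line is literally
    that of the directional derivative along [v]. *)
Lemma grad_lineP n (f : 'cV[R]_n -> R) (x v : 'cV[R]_n) (t : R) :
  (forall y, differentiable f y) ->
  is_derive t (1 : R) (fun s : R => f (x + s *: v))
    (dotv (grad f (x + t *: v)) v).
Proof.
move=> df.
have quotientE :
    (fun k : R => k^-1 *: (f (x + (k *: (1 : R) + t) *: v) - f (x + t *: v))) =
    (fun k : R => k^-1 *: (f (k *: v + (x + t *: v)) - f (x + t *: v))).
  apply/funext => k; congr (_ *: (f _ - _)).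
  by rewrite [k *: 1]mulr1 scalerDl addrCA.
apply: DeriveDef; last by rewrite dotv_grad // /derive /= quotientE.
by rewrite /derivable /= quotientE; apply: diff_derivable.
Qed.

(** Subtracting the tangent line and the parabola of curvature [C] leaves a
    function with nonpositive derivative on the unit interval. *)
Lemma descent_line (g dg : R -> R) (C : R) :
  (forall t : R, is_derive t (1 : R) g (dg t)) ->
  (forall t : R, 0 <= t -> dg t - dg 0 <= C * t) ->
  g 1 <= g 0 + dg 0 + C / 2.
Proof.
move=> g_dg dg_le.
pose phi := fun t : R => g t - t * dg 0 - t ^+ 2 * (C / 2).
have phi_d (t : R) : is_derive t (1 : R) phi (dg t - dg 0 - t * C).
  apply: is_derive_eq; rewrite !scaler0 !add0r /GRing.scale /=.
  by field.
have : phi 1 <= phi 0.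
  apply: (@ler0_derive1_nincr R phi 0 1) => //.
  - move=> t; rewrite in_itv /= => /andP[t0 _].
    by rewrite derive1E derive_val; have := dg_le _ (ltW t0); lra.
  - apply: continuous_subspaceT => t; apply: differentiable_continuous.
    exact/derivable1_diffP.
by rewrite /phi; lra.
Qed.

Lemma dotvB n (a b h : 'cV[R]_n) : dotv (a - b) h = dotv a h - dotv b h.
Proof. by rewrite /dotv linearB mulmxBl mxE [X in _ + X]mxE. Qed.

Lemma dotvZ n (a h : 'cV[R]_n) (t : R) : dotv a (t *: h) = t * dotv a h.
Proof. by rewrite /dotv -scalemxAr mxE. Qed.

Lemma normBZ n (C : 'M[R]_n) (h : 'cV[R]_n) (t : R) :
  0 <= t -> normB C (t *: h) = t * normB C h.
Proof.
move=> t0; rewrite /normB (_ : (t *: h)^T = t *: h^T); last by rewrite linearZ.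
rewrite -!scalemxAl -scalemxAr scalerA mxE.
by rewrite sqrtrM ?sqr_ge0 // -expr2 sqrtr_sqr ger0_norm.
Qed.

(** The derivative of [f] along the segment from [x] to [x + U i *m h] grows at
    rate at most L_i |h|_i^2: pair the change of the block gradient with [h] and
    apply the Lipschitz bound with base point [x]. *)
Lemma block_descent n m (p : 'I_m -> nat) (U : forall i, 'M[R]_(n, p i))
    (B : forall i, 'M[R]_(p i)) (L : 'I_m -> R) (f : 'cV[R]_n -> R) i x h :
  posdefmx (B i) -> (forall y, differentiable f y) ->
  (forall h, dual_normB (B i)
       (blk U i (grad f (x + U i *m h)) - blk U i (grad f x))
     <= L i * normB (B i) h) ->
  f (x + U i *m h) <=
    f x + dotv (blk U i (grad f x)) h + L i * normB (B i) h ^+ 2 / 2.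
Proof.
move=> hB df Lip.
have dotvU a : dotv a (U i *m h) = dotv (blk U i a) h.
  by rewrite /dotv /blk trmx_mul trmxK mulmxA.
have := @descent_line (fun s => f (x + s *: (U i *m h)))
  (fun s => dotv (grad f (x + s *: (U i *m h))) (U i *m h))
  (L i * normB (B i) h ^+ 2) (fun t => grad_lineP x (U i *m h) t df).
rewrite scale0r addr0 scale1r !dotvU; apply => t t0.
have -> : dotv (grad f (x + t *: (U i *m h))) (U i *m h) -
    dotv (blk U i (grad f x)) h =
    dotv (blk U i (grad f (x + U i *m (t *: h))) - blk U i (grad f x)) h.
  by rewrite dotvU scalemxAr dotvB.
apply: (le_trans (dotv_dual_le hB _ _)).
have -> : L i * normB (B i) h ^+ 2 * t =
    L i * normB (B i) (t *: h) * normB (B i) h.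
  by rewrite normBZ //; ring.
by rewrite ler_wpM2r ?sqrtr_ge0.
Qed.

End Smoothness.

(** * Expected overapproximation for a partially separable function *)

Section SamplingBound.
Variables (R : realType) (n m : nat) (p : 'I_m -> nat).
Variable U : forall i : 'I_m, 'M[R]_(n, p i).
Hypothesis hU : block_decomposition U.
Variable w : 'I_m -> R.
Hypotheses (w_ge0 : forall i, 0 <= w i) (w_sum1 : \sum_i w i = 1).
Variables (x h : 'cV[R]_n).

Local Notation step i := (U i *m blk U i h).

Lemma hit_prob_ge0 (A : {set 'I_m}) : 0 <= hit_prob w A.
Proof. by apply: sumr_ge0. Qed.

(** A component depending on the blocks of [A] sees only the draws that hit [A].
    Convexity bounds its increase by a sum of chord slopes at the number of hits,
    whose law given one hit is 1 + Bin(tau - 1, hit_prob A). Slopes are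
    nondecreasing, so that probability may be raised to a common [rho]; the bound
    then has the same form for all components, and the sum may run over all
    indices because the slope vanishes outside [A]. *)
Lemma mean_component_le (A : {set 'I_m}) (g : 'cV[R]_n -> R) rho tau :
  convex_fun g -> depends_only_on U A g -> hit_prob w A <= rho -> rho <= 1 ->
  mean w tau (fun s => g (x + \sum_(i <- s) step i))
  <= g x + tau%:R * \sum_i w i *
       iter tau.-1 (binomial_step rho) (chord_slope g x (step i)) 0.
Proof.
move=> cg dep wA_rho rho1.
have slope_out i c : i \notin A -> chord_slope g x (step i) c = 0.
  move=> iA; rewrite /chord_slope (dep _ x) ?subrr ?mul0r // => j jA.
  have ji : j != i by apply: contraNneq iA => <-.
  by rewrite /blk mulmxDr -scalemxAr -!/(blk U j _) blk_disjoint // scaler0 addr0.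
have hits (s : seq 'I_m) : g (x + \sum_(i <- s) step i) =
    g (x + \sum_(i <- s | i \in A) step i).
  apply: dep => j jA; rewrite /blk !mulmxDr; congr (_ + _).
  rewrite (bigID (mem A)) /= mulmxDr [X in _ + X]mulmx_sumr.
  rewrite [X in _ + X]big1 ?addr0 // => i iA.
  have ji : j != i by apply: contraNneq iA => <-.
  exact: blk_disjoint.
apply: (@le_trans _ _ (mean w tau (fun s => g x + \sum_(i <- s | i \in A)
    chord_slope g x (step i) (0 + (count [in A] s).-1)%N))).
  apply: le_mean => // s _.
  rewrite hits -lerBlDl -[X in g (_ + X)]big_filter.
  rewrite -[leRHS]big_filter -size_filter.
  exact: sub_le_sum_chord_slope.
rewrite meanD mean_cst // lerD2l.
rewrite (mean_hits w_sum1 A tau (fun i => chord_slope g x (step i))).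
rewrite ler_wpM2l // [leRHS](bigID (mem A)) /=.
rewrite [X in _ <= _ + X]big1 ?addr0; last first.
  move=> i iA; rewrite (_ : chord_slope g x (step i) = fun k => 0 + 0 * k%:R).
    by rewrite binomial_step_affine mul0r addr0 mulr0.
  by apply/funext => k; rewrite slope_out // mul0r addr0.
apply: ler_sum => i _; rewrite ler_wpM2l //.
apply: binomial_step_le_prob => //; first exact: hit_prob_ge0.
by move=> c; exact: chord_slope_le.
Qed.

(** With a common law 1 + Bin(tau - 1, rho) for all components, the chord slopes
    of the components add up to those of [f], and only there is the smoothness
    of [f] used: its chord slopes are at most affine in the number of hits, so only
    the expected number of hits 1 + (tau - 1) rho remains. *)
Lemma mean_separable_le (S : {set {set 'I_m}})
    (fS : {set 'I_m} -> 'cV[R]_n -> R) (f : 'cV[R]_n -> R) rho tau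
    (a b : 'I_m -> R) :
  (forall y, f y = \sum_(A in S) fS A y) ->
  (forall A, A \in S ->
     [/\ convex_fun (fS A), depends_only_on U A (fS A) & hit_prob w A <= rho]) ->
  0 <= rho <= 1 -> (0 < tau)%N ->
  (forall i (c : R), 0 < c ->
     f (x + c *: step i) <= f x + c * a i + c ^+ 2 * b i) ->
  mean w tau (fun s => f (x + \sum_(i <- s) step i))
  <= f x + tau%:R * \sum_i w i * (a i + (1 + (tau%:R - 1) * rho) * b i).
Proof.
move=> f_sum fSP rho01 tau0 upper.
apply: (@le_trans _ _ (f x + tau%:R * \sum_i w i *
    iter tau.-1 (binomial_step rho) (chord_slope f x (step i)) 0)).
  rewrite (eq_mean w tau (fun s => f_sum _)) mean_sum f_sum.
  apply: (@le_trans _ _ (\sum_(A in S) (fS A x + tau%:R * \sum_i w i *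
       iter tau.-1 (binomial_step rho) (chord_slope (fS A) x (step i)) 0))).
    apply: ler_sum => A /fSP[cA dA wA].
    by apply: (mean_component_le _ cA dA wA); case/andP: rho01.
  rewrite big_split /= lerD2l -mulr_sumr exchange_big /= ler_wpM2l //.
  apply: ler_sum => i _; rewrite -mulr_sumr -binomial_step_sum.
  rewrite (_ : (fun k => \sum_(A in S) _) = chord_slope f x (step i)) //.
  by apply/funext => k; rewrite /chord_slope -mulr_suml sumrB -!f_sum.
rewrite lerD2l ler_wpM2l //; apply: ler_sum => i _; rewrite ler_wpM2l //.
have -> : a i + (1 + (tau%:R - 1) * rho) * b i =
    iter tau.-1 (binomial_step rho) (fun k => (a i + b i) + b i * k%:R) 0.
  rewrite binomial_step_affine -[in LHS](prednK tau0) -natr1; ring.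
apply: binomial_step_le => // c.
have c0 : 0 < c.+1%:R :> R by rewrite ltr0n.
rewrite /chord_slope ler_pdivrMr // lerBlDl (le_trans (upper _ _ c0)) //.
by rewrite -natr1 le_eqVlt; apply/orP; left; apply/eqP; ring.
Qed.

End SamplingBound.

(** * Sampling with two inclusion weights *)

Theorem lemma2 (R : realType) (n m : nat) (p : 'I_m -> nat)
  (U : forall i : 'I_m, 'M[R]_(n, p i)) (hU : block_decomposition U)
  (l u : 'cV[\bar R]_n) (hlu : forall j : 'I_n, (l j 0%R < u j 0%R)%E)
  (f : 'cV[R]_n -> R) (f_convex : convex_fun f)
  (f_smooth : forall y : 'cV[R]_n, differentiable f y)
  (psi : 'cV[R]_n -> R) (psi_convex : convex_fun psi)
  (psib : forall i : 'I_m, 'cV[R]_(p i) -> R)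
  (psi_sep : forall y : 'cV[R]_n, psi y = \sum_(i < m) psib i (blk U i y))
  (B : forall i : 'I_m, 'M[R]_(p i)) (hB : forall i : 'I_m, posdefmx (B i))
  (L : 'I_m -> R) (hL : forall i : 'I_m, 0 < L i)
  (f_Lip : forall (i : 'I_m) (y : 'cV[R]_n) (h : 'cV[R]_(p i)), box l u y ->
     dual_normB (B i)
       (blk U i (grad f (y + U i *m h)) - blk U i (grad f y))
     <= L i * normB (B i) h)
  (omega : nat) (f_psep : partially_separable U omega f)
  (x : 'cV[R]_n) (hx : box l u x)
  (I J : {set 'I_m}) (IJ_disj : (I :&: J)%SET = finset.set0)
  (IJ_cover : (I :|: J)%SET = [set: 'I_m]%SET)
  (delta tau : nat) (delta_gt0 : (0 < delta)%N) (tau_gt0 : (0 < tau)%N)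
  (q : R) (hq : q = delta%:R * #|I|%:R + #|J|%:R)
  (beta : R)
  (hbeta : beta = (tau%:R - 1) *
     (delta%:R * (minn #|I| omega)%:R + (minn #|J| omega)%:R) / q + 1)
  (d : measure_display) (Omega : measurableType d) (P : probability Omega R)
  (draw : 'I_tau -> Omega -> 'I_m)
  (draw_random : forall k : 'I_tau, fin_random (draw k))
  (draw_indep : mutually_independent P draw)
  (draw_I : forall (k : 'I_tau) (i : 'I_m), i \in I ->
     P (draw k @^-1` [set i]%classic) = (delta%:R / q)%:E)
  (draw_J : forall (k : 'I_tau) (i : 'I_m), i \in J ->
     P (draw k @^-1` [set i]%classic) = (1 / q)%:E)
  (hb : 'cV[R]_n)
  (hb_sol : forall i : 'I_m,
     is_argmin [set h : 'cV[R]_(p i) | box l u (x + U i *m h)]%classic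
       (fun h : 'cV[R]_(p i) =>
          dotv (blk U i (grad f x)) h
          + beta * L i / 2 * normB (B i) h ^+ 2
          + psib i (blk U i x + h) - psib i (blk U i x))
       (blk U i hb)) :
  ('E_P[fun w : Omega =>
          (f (x + \sum_(k < tau) U (draw k w) *m blk U (draw k w) hb))%R]
   <= (f x
       + \sum_(i in I) tau%:R * delta%:R / q *
           (dotv (blk U i (grad f x)) (blk U i hb)
            + beta * L i / 2 * normB (B i) (blk U i hb) ^+ 2)
       + \sum_(i in J) tau%:R / q *
           (dotv (blk U i (grad f x)) (blk U i hb)
            + beta * L i / 2 * normB (B i) (blk U i hb) ^+ 2))%R%:E)%E.
Proof.
(* A sample space is nonempty and at least one index is drawn, so 0 < m; this
   is what makes q nonzero. *)
pose i0 : 'I_m := draw (Ordinal tau_gt0) point.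
have J_notI i : (i \in J) = (i \notin I).
  have := finset.in_setT i; rewrite -IJ_cover inE => iIJ.
  have := finset.in_set0 i; rewrite -IJ_disj inE.
  by move: iIJ; case: (i \in I); case: (i \in J).
have q_gt0 : 0 < q.
  have card_gt0 (A : {set 'I_m}) : i0 \in A -> 0 < #|A|%:R :> R.
    by move=> iA; rewrite ltr0n; apply/card_gt0P; exists i0.
  rewrite hq; have [iI|] := boolP (i0 \in I).
    by rewrite ltr_wpDr ?ler0n // mulr_gt0 ?card_gt0 ?ltr0n.
  by rewrite -J_notI => iJ; rewrite ltr_wpDl ?card_gt0 ?mulr_ge0 ?ler0n.
pose w i : R := if i \in I then delta%:R / q else 1 / q.
have w_ge0 i : 0 <= w i.
  by rewrite /w; case: ifP => _; rewrite divr_ge0 ?ler0n ?ler01 ?(ltW q_gt0).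
have draw_w k i : P (draw k @^-1` [set i]) = (w i)%:E.
  rewrite /w; case: ifPn => iI; first exact: draw_I.
  by rewrite draw_J // J_notI.
have sum_w (F : 'I_m -> R) (A : {set 'I_m}) : \sum_(i in A) w i * F i =
    \sum_(i in A :&: I) delta%:R / q * F i + \sum_(i in A :&: J) 1 / q * F i.
  rewrite (bigID (mem I)) /=; congr (_ + _).
    apply: eq_big => [i|i /andP[_ iI]]; first by rewrite inE.
    by rewrite /w iI.
  apply: eq_big => [i|i /andP[_ /negbTE iI]]; first by rewrite inE J_notI.
  by rewrite /w iI.
have hit_probE A :
    hit_prob w A = (delta%:R * #|A :&: I|%:R + #|A :&: J|%:R) / q.
  transitivity (\sum_(i in A) w i * 1); first by under eq_bigr do rewrite mulr1.
  rewrite sum_w !sumr_const -[X in X + _ = _]mulr_natr.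
  rewrite -[X in _ + X = _]mulr_natr.
  by ring.
have w_sum1 : \sum_i w i = 1.
  have := hit_probE [set: 'I_m]%SET.
  rewrite !finset.setTI -hq divff ?gt_eqF // => <-.
  by apply: eq_bigl => i; rewrite inE.
(* A common bound on the probabilities that a draw hits a component. *)
pose rho := (delta%:R * (minn #|I| omega)%:R + (minn #|J| omega)%:R) / q.
have rho01 : 0 <= rho <= 1.
  rewrite divr_ge0 ?addr_ge0 ?mulr_ge0 ?ler0n ?(ltW q_gt0) //=.
  rewrite ler_pdivrMr // mul1r hq lerD // ?ler_nat ?geq_minl //.
  by rewrite ler_wpM2l ?ler0n // ler_nat geq_minl.
have betaE : beta = 1 + (tau%:R - 1) * rho by rewrite hbeta /rho mulrA addrC.
have [S [fS [f_sum fSP]]] := f_psep.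
pose a i := dotv (blk U i (grad f x)) (blk U i hb).
pose b i := L i / 2 * normB (B i) (blk U i hb) ^+ 2.
have upper i (c : R) : 0 < c ->
    f (x + c *: (U i *m blk U i hb)) <= f x + c * a i + c ^+ 2 * b i.
  move=> c0; rewrite scalemxAr.
  apply: (le_trans (block_descent (L := L) _ (hB i) f_smooth
    (fun h => f_Lip i x h hx))).
  rewrite dotvZ normBZ ?(ltW c0) // /a /b le_eqVlt; apply/orP; left; apply/eqP.
  by field.
have bound := mean_separable_le hU w_ge0 w_sum1 f_sum _ rho01 tau_gt0 upper.
pose F (s : seq 'I_m) := f (x + \sum_(i <- s) U i *m blk U i hb).
have -> : (fun v : Omega =>
      f (x + \sum_(k < tau) U (draw k v) *m blk U (draw k v) hb)) =
    (fun v => F [seq draw k v | k <- enum 'I_tau]).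
  by apply/funext => v; rewrite /F big_map big_enum.
rewrite (expectation_iid F draw_random draw_indep draw_w) lee_fin.
apply: (le_trans (bound _)) => [A AS|].
  have [_ Aomega _ cA dA] := fSP A AS; split => //.
  (* This is where the minima in beta come from: A meets I in at most |I|
     indices and in at most omega of them, and likewise J. *)
  rewrite hit_probE ler_pM2r ?invr_gt0 //.
  have card_le (D : {set 'I_m}) : (#|A :&: D| <= minn #|D| omega)%N.
    rewrite leq_min subset_leq_card ?subsetIr //.
    exact: leq_trans (subset_leq_card (subsetIl _ _)) Aomega.
  by rewrite lerD ?ler_wpM2l ?ler_nat ?ler0n.
rewrite -betaE -addrA lerD2l.
rewrite (_ : \sum_i _ = \sum_(i in [set: 'I_m]%SET) w i * (a i + beta * b i)).
  rewrite sum_w !finset.setTI mulrDr !mulr_sumr.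
  rewrite le_eqVlt; apply/orP; left; apply/eqP.
  by congr (_ + _); apply: eq_bigr => i _; rewrite /a /b; ring.
by apply: eq_bigl => i; rewrite inE.
Qed.
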